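(* Let $1\le p<\infty$ and let $(T_{\tau(s),\delta(s),\varphi,b})_{s\geq 1}$ be a countable family of operators of $C_{+,1}$-type on $\ell^p(\mathbb{N})$ where $b$ does not depend on $s$. If $$\inf_{t\geq1}\limsup_{k\to\infty}\frac{\delta^{(k)}(t)-\tau^{(k)}(t)}{\Delta^{(k)}}>0,$$ then $\bigcap_{s\geq 1}FHC(T_{\tau(s),\delta(s),\varphi,b})$ is non-empty.
   Context: $\mathbb{N}=\{0,1,2,\ldots\}$, $(e_k)_{k\in\mathbb{N}}$ is the unit sequence of $\ell^p(\mathbb{N})$ (complex scalars). Operators of $C$-type. The data are: - $v=(v_n)_{n\geq 1}$, non-zero complex numbers with $\sum_{n\geq 1}|v_n|<\infty$; - $w=(w_n)_{n\geq 1}$, complex numbers with $0<\inf_{n\geq 1}|w_n|\leq\sup_{n\geq 1}|w_n|<\infty$; - $\varphi:\mathbb{N}\to\mathbb{N}$ with $\varphi(0)=0$, $\varphi(n)<n$ for $n\geq 1$, and $\varphi^{-1}(\{l\})$ infinite for every $l\geq 0$; - $b=(b_n)_{n\geq 0}$, a (strictly) increasing sequence of integers with $b_0=0$ and $b_{n+1}-b_n$ a multiple of $2(b_{\varphi(n)+1}-b_{\varphi(n)})$ for every $n\geq 1$. It is assumed throughout that $\inf_{n\geq 0}\prod_{b_n<j<b_{n+1}}|w_j|>0$. Empty products equal $1$. The operator of $C$-type $T_{v,w,\varphi,b}$ is the bounded operator on $\ell^p(\mathbb{N})$ determined by $$T_{v,w,\varphi,b}(e_k)=\begin{cases} w_{k+1}e_{k+1}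 & \text{if } k\in[b_n,b_{n+1}-1),\ n\geq 0,\\ v_ne_{b_{\varphi(n)}}-\Big(\prod_{j=b_n+1}^{b_{n+1}-1}w_j\Big)^{-1}e_{b_n} & \text{if } k=b_{n+1}-1,\ n\geq 1,\\ -\Big(\prod_{j=b_0+1}^{b_1-1}w_j\Big)^{-1}e_0 & \text{if } k=b_1-1.\end{cases}$$ Operators of $C_+$-type: operators of $C$-type such that for every $k\geq 1$: - $\varphi(n)=n-2^{k-1}$ for every $n\in[2^{k-1},2^k)$; - there is $\Delta^{(k)}\in\mathbb{N}$ with $b_{n+1}-b_n=\Delta^{(k)}$ for every $n\in[2^{k-1},2^k)$; - there is $v^{(k)}\in\mathbb{C}\setminus\{0\}$ with $v_n=v^{(k)}$ for every $n\in[2^{k-1},2^k)$; - there is a sequence $(w_i^{(k)})_{1\leq i<\Delta^{(k)}}$ with $w_{b_n+i}=w_i^{(k)}$ for every $1\leq i<\Delta^{(k)}$ and every $n\in[2^{k-1},2^k)$. Operators of $C_{+,1}$-type: operators of $C_+$-type such that for every $k\geq 1$, $v^{(k)}=2^{-\tau^{(k)}}$, $w_i^{(k)}=2$ if $1\leq i\leq\delta^{(k)}$ and $w_i^{(k)}=1$ if $\delta^{(k)}<i<\Delta^{(k)}$, where $\tau=(\tau^{(k)})_{k\geq 1}$ and $\delta=(\delta^{(k)})_{k\geq 1}$ are strictly increasing sequences of integers with $\delta^{(k)}<\Delta^{(k)}$ for $k\geq 1$. Such an operator is denoted $T_{\tau,\delta,\varphi,b}$. (The entries $w_j$ not prescribed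 by these conditions are only subject to the general $C$-type conditions.) For the family indexed by $s$, $\tau(s)=(\tau^{(k)}(s))_k$ and $\delta(s)=(\delta^{(k)}(s))_k$ depend on $s$, while $b$, hence $\Delta^{(k)}$, does not. $FHC(T)$ is the set of frequently hypercyclic vectors of $T$: those $x$ such that for every non-empty open $U$, $\underline{d}(\{n\in\mathbb{N}:T^n(x)\in U\})>0$, where $\underline{d}(E)=\liminf_{n\to\infty}\frac{\mathrm{card}([0,n]\cap E)}{n+1}$. *)

(* Defs.v *)
From HB Require Import structures.
From mathcomp Require Import all_boot all_order all_algebra.
From mathcomp Require Import all_classical all_reals all_analysis.
From mathcomp Require Import complex.

Set Implicit Arguments.
Unset Strict Implicit.
Unset Printing Implicit Defensive.

Import Order.TTheory GRing.Theory Num.Theory Normc.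
Import numFieldNormedType.Exports.

Local Open Scope classical_set_scope.
Local Open Scope ring_scope.
Local Open Scope complex_scope.

(** * The space l^p(N) of complex sequences, for a real number p >= 1 *)

Section lpnorm.
Context {R : realType} (p : R).
Implicit Types (x y : nat -> R[i]) (z : R[i]).

Definition lpnorm x : \bar R :=
  'N[counting]_p%:E[(fun n => (normc (x n))%:E)].

Definition lp_finite (p1 : 1 <= p) : {pred nat -> R[i]} :=
  fun x => (lpnorm x < +oo)%E.

Lemma normc_ge0 z : 0 <= normc z.
Proof. by case: z => a b /=; rewrite sqrtr_ge0. Qed.

Lemma normrcE z : `|z| = (normc z)%:C.
Proof. by case: z. Qed.

Lemma lpnorm_ge0 x : (0 <= lpnorm x)%E.
Proof. exact: Lnorm_ge0. Qed.

Hypothesis p1 : 1 <= p.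

Let p0 : 0 < p. Proof. exact: lt_le_trans ltr01 p1. Qed.

Lemma lpnormE x :
  lpnorm x = ((\sum_(0 <= n <oo) (normc (x n) `^ p)%:E) `^ p^-1)%E.
Proof.
rewrite /lpnorm Lnorm_counting//; congr (_ `^ _)%E.
by apply: eq_eseriesr => n _; rewrite /= ger0_norm// normc_ge0.
Qed.

Lemma lpnorm0 : lpnorm 0 = 0%E.
Proof.
rewrite lpnormE eseries0 ?poweR0r ?invr_neq0 ?gt_eqF// => n _ _.
by rewrite [X in normc X](_ : _ = 0)// normc0 powR0// gt_eqF.
Qed.

Lemma ler_lpnormD x y : (lpnorm (x + y)%R <= lpnorm x + lpnorm y)%E.
Proof.
have /= := @minkowski_EFin _ _ R counting (fun n => normc (x n))
  (fun n => normc (y n)) p _ _ p1.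
move=> /(_ (fun _ _ _ => I) (fun _ _ _ => I)).
apply: le_trans; rewrite lpnormE Lnorm_counting//.
have ge0 (u : nat -> R) : (0 <= \sum_(0 <= n <oo) (u n `^ p)%:E)%E.
  by apply: nneseries_ge0 => n _ _; rewrite lee_fin powR_ge0.
apply: gt0_ler_poweR; first by rewrite invr_ge0 ltW.
- by rewrite in_itv/= leey andbT ge0.
- by rewrite in_itv/= leey andbT ge0.
apply: lee_nneseries => n _; first by rewrite lee_fin powR_ge0.
rewrite /= lee_fin ge0_ler_powR ?nnegrE ?normc_ge0 ?(ltW p0)//.
exact: le_trans (@le_normcD R (x n) (y n)) (ler_norm _).
Qed.

Lemma lpnormZ z x : lpnorm (z *: x) = ((normc z)%:E * lpnorm x)%E.
Proof.
rewrite !lpnormE.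
under eq_eseriesr do
  rewrite -[(z *: x) _]/(z * x _) normcM powRM ?normc_ge0// EFinM.
rewrite nneseriesZl; last by move=> n _; rewrite lee_fin powR_ge0.
rewrite poweRM ?lee_fin ?powR_ge0//; last first.
  by apply: nneseries_ge0 => n _ _; rewrite lee_fin powR_ge0.
by rewrite poweR_EFin -powRrM mulfV ?gt_eqF// powRr1 ?normc_ge0.
Qed.

Lemma lpnorm_eq0 x : lpnorm x = 0%E -> x = 0.
Proof.
have h n : (0 <= (normc (x n) `^ p)%:E)%E by rewrite lee_fin powR_ge0.
rewrite lpnormE => /poweR_eq0_eq0 s0; apply/funext => n; apply: eq0_normc.
have /eqP : (\sum_(0 <= n <oo) (normc (x n) `^ p)%:E)%E = 0%E.
  by apply: s0; apply: nneseries_ge0.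
rewrite (@nneseriesD1 _ _ n xpredT)// padde_eq0 ?nneseries_ge0//.
by case/andP => /eqP[/powR_eq0_eq0].
Qed.

Fact lp_finite_submod_closed : submod_closed (lp_finite p1).
Proof.
split; first by rewrite unfold_in /= lpnorm0 ltry.
move=> z x y; rewrite !unfold_in/= => fx fy.
apply: le_lt_trans (ler_lpnormD _ _) _; rewrite lpnormZ lte_add_pinfty//.
by rewrite lte_mul_pinfty ?lee_fin ?normc_ge0.
Qed.

HB.instance Definition _ :=
  GRing.isSubmodClosed.Build R[i] (nat -> R[i]) (lp_finite p1)
    lp_finite_submod_closed.

End lpnorm.

(** As in [LfunType], the proof of [1 <= p] is a parameter of the type, so that
    the normed structure can be inferred. *)
Record ell (R : realType) (p : R) (p1 : 1 <= p) := Ell {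
  ell_seq :> nat -> R[i];
  _ : ell_seq \in lp_finite p1 }.

Section ell_normed.
Context {R : realType} {p : R} {p1 : 1 <= p}.
Local Notation V := (ell p1).
Implicit Types x y : V.

HB.instance Definition _ := [isSub for @ell_seq R p p1].
HB.instance Definition _ := [Choice of V by <:].
HB.instance Definition _ := [SubChoice_isSubLmodule of V by <:].

(** The norm of a normed module over [R[i]] must take its values in [R[i]]. *)
Definition ell_norm x : R[i] := (fine (lpnorm p x))%:C.

Let lpnorm_fin x : lpnorm p x \is a fin_num.
Proof. by rewrite ge0_fin_numE ?lpnorm_ge0//; exact: (valP x). Qed.

Fact ell_normD x y : ell_norm (x + y) <= ell_norm x + ell_norm y.
Proof.
rewrite /ell_norm -rmorphD lecR -fineD// fine_le// ?fin_numD ?lpnorm_fin//.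
exact: ler_lpnormD.
Qed.

Fact ell_normZ (z : R[i]) x : ell_norm (z *: x) = `|z| * ell_norm x.
Proof.
rewrite /ell_norm [X in lpnorm p X](_ : _ = z *: (x : nat -> R[i]))//.
by rewrite lpnormZ// fineM// normrcE rmorphM.
Qed.

Fact ell_norm_eq0 x : ell_norm x = 0 -> x = 0.
Proof.
move=> /complexI x0; apply: val_inj; apply: lpnorm_eq0 p1 _ _ => /=.
by rewrite -(fineK (lpnorm_fin x)) x0.
Qed.

HB.instance Definition _ :=
  Lmodule_isNormed.Build R[i] V ell_normD ell_normZ ell_norm_eq0.

End ell_normed.

Section unit_sequence.
Context {R : realType} {p : R} {p1 : 1 <= p}.

Fact ell_unit_subproof (k : nat) :
  (fun n => (n == k)%:R : R[i]) \in lp_finite p1.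
Proof.
rewrite unfold_in /= lpnormE// poweR_lty// (@nneseriesD1 _ _ k xpredT)//.
  rewrite eseries0 ?adde0 ?ltry// => n _ /= /negbTE ->.
  by rewrite normc0 powR0// gt_eqF// (lt_le_trans ltr01).
by move=> n _; rewrite lee_fin powR_ge0.
Qed.

Definition ell_unit k : ell p1 := Ell (ell_unit_subproof k).

End unit_sequence.

(** * Operators of C-type *)

(** [v] and [w] are sequences indexed by n >= 1: [v 0] and [w 0] are junk. *)
Record Ctype_data (R : realType) (v w : nat -> R[i]) (phi b : nat -> nat) :
    Prop := {
  Ctype_v_neq0 : forall n, (1 <= n)%N -> v n != 0 ;
  Ctype_v_summable : (\sum_(1 <= n <oo) (normc (v n))%:E < +oo)%E ;
  Ctype_w_inf :
    (0 < ereal_inf [set (normc (w n))%:E | n in [set n | (1 <= n)%N]])%E ;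
  Ctype_w_sup :
    (ereal_sup [set (normc (w n))%:E | n in [set n | (1 <= n)%N]] < +oo)%E ;
  Ctype_phi0 : phi 0%N = 0%N ;
  Ctype_phi_lt : forall n, (1 <= n)%N -> (phi n < n)%N ;
  Ctype_phi_infinite : forall l, infinite_set (phi @^-1` [set l]) ;
  Ctype_b0 : b 0%N = 0%N ;
  Ctype_b_incr : {homo b : m n / (m < n)%N} ;
  Ctype_b_dvd : forall n, (1 <= n)%N ->
    (2 * (b (phi n).+1 - b (phi n)) %| b n.+1 - b n)%N ;
  Ctype_w_prod :
    (0 < ereal_inf
       (range (fun n => (\prod_((b n).+1 <= j < b n.+1) normc (w j))%:E)))%E }.

Record Ctype_operator (R : realType) (p : R) (p1 : 1 <= p)
    (v w : nat -> R[i]) (phi b : nat -> nat)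
    (T : {linear ell p1 -> ell p1}) : Prop := {
  Ctype_operator_data : Ctype_data v w phi b ;
  Ctype_operator_bounded : continuous T ;
  Ctype_operator_shift : forall n k, (b n <= k < (b n.+1).-1)%N ->
    T (ell_unit k) = w k.+1 *: ell_unit k.+1 ;
  Ctype_operator_end : forall n, (1 <= n)%N ->
    T (ell_unit (b n.+1).-1) =
      v n *: ell_unit (b (phi n))
      - (\prod_((b n).+1 <= j < b n.+1) w j)^-1 *: ell_unit (b n) ;
  Ctype_operator_end0 :
    T (ell_unit (b 1%N).-1) =
      - ((\prod_((b 0%N).+1 <= j < b 1%N) w j)^-1 *: ell_unit 0) }.

(** [Delta k], [vk k] and [wk k i] are written Delta^(k), v^(k) and w_i^(k);
    only [1 <= k] and [1 <= i < Delta k] matter. *)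
Record Cplus_data (R : realType) (v w : nat -> R[i]) (phi b : nat -> nat)
    (Delta : nat -> nat) (vk : nat -> R[i]) (wk : nat -> nat -> R[i]) :
    Prop := {
  Cplus_phi : forall k n, (1 <= k)%N -> (2 ^ k.-1 <= n < 2 ^ k)%N ->
    phi n = (n - 2 ^ k.-1)%N ;
  Cplus_Delta : forall k n, (1 <= k)%N -> (2 ^ k.-1 <= n < 2 ^ k)%N ->
    (b n.+1 - b n)%N = Delta k ;
  Cplus_vk_neq0 : forall k, (1 <= k)%N -> vk k != 0 ;
  Cplus_v : forall k n, (1 <= k)%N -> (2 ^ k.-1 <= n < 2 ^ k)%N ->
    v n = vk k ;
  Cplus_w : forall k n i, (1 <= k)%N -> (2 ^ k.-1 <= n < 2 ^ k)%N ->
    (1 <= i < Delta k)%N -> w (b n + i)%N = wk k i }.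

Record Cplus1_data (R : realType) (tau delta : nat -> int)
    (Delta : nat -> nat) (vk : nat -> R[i]) (wk : nat -> nat -> R[i]) :
    Prop := {
  Cplus1_tau_incr : forall k l, (1 <= k < l)%N -> tau k < tau l ;
  Cplus1_delta_incr : forall k l, (1 <= k < l)%N -> delta k < delta l ;
  Cplus1_delta_lt : forall k, (1 <= k)%N -> delta k < (Delta k)%:Z ;
  Cplus1_v : forall k, (1 <= k)%N -> vk k = 2 ^ (- tau k) ;
  Cplus1_w2 : forall k (i : nat), (1 <= k)%N ->
    (1 <= i)%N -> i%:Z <= delta k -> wk k i = 2 ;
  Cplus1_w1 : forall k (i : nat), (1 <= k)%N ->
    (1 <= i < Delta k)%N -> delta k < i%:Z -> wk k i = 1 }.

(** The weights [w j] with [0 < j < b 1] act in [T] but are not prescribed by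
    [tau] and [delta], hence the existential quantification over [w]. *)
Definition Cplus1_operator (R : realType) (p : R) (p1 : 1 <= p)
    (tau delta : nat -> int) (phi b Delta : nat -> nat)
    (T : {linear ell p1 -> ell p1}) : Prop :=
  exists v w vk wk,
    [/\ Ctype_operator v w phi b T,
        Cplus_data v w phi b Delta vk wk &
        Cplus1_data tau delta Delta vk wk].

(** * Frequent hypercyclicity *)

Definition lower_density (R : realType) (E : set nat) : \bar R :=
  limn_einf (fun n => (#|[pred i : 'I_n.+1 | (i : nat) \in E]|%:R
                       / n.+1%:R : R)%:E).

Definition FHC (R : realType) (V : normedModType R[i]) (T : V -> V) : set V :=
  [set x | forall U : set V, open U -> U !=set0 ->
    (0 < lower_density R [set n | U (iter n T x)])%E].

(* Main.v *)
Require Import Defs.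
From mathcomp Require Import all_boot all_order all_algebra.
From mathcomp Require Import all_classical all_reals all_analysis.
From mathcomp Require Import complex.
From mathcomp Require Import zify ring lra.

Set Implicit Arguments.
Unset Strict Implicit.
Unset Printing Implicit Defensive.

Import Order.TTheory GRing.Theory Num.Theory Normc.
Import numFieldNormedType.Exports.

Local Open Scope classical_set_scope.
Local Open Scope ring_scope.
Local Open Scope complex_scope.

(** The operators share the block structure [b], so two facts hold for all of
    them at once.  With [D = Delta k], [D] is a period of every vector carried
    by the blocks [n < 2 ^ (k - 1)], because [2 (b (n+1) - b n)] divides [D];
    and [2 D] is a period of every vector carried by the blocks [n < 2 ^ k].

    Going once around block [n + 2 ^ (k - 1)] feeds the amount
    [2 ^ (delta k - tau k)] into the start of block [n] and reverses the sign of
    the original vector.  Hence a vector [g] on the old blocks has a copy [J g]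
    on the new ones with [T^D (J g) = 2 ^ (delta k - tau k) g - J g], whose norm
    is bounded independently of [k] ([vector_shift]).  The rescaled copy
    [z = 2 ^ (tau k - delta k) J g] satisfies [T^D z = g - z].  The hypothesis
    on the upper limits gives an integer [N], common to all operators, such that
    [Delta k <= N (delta k - tau k)] for infinitely many [k]
    ([uniform_ratio]); for those, [z] is exponentially small in [D], so every
    bounded operator [T s'] keeps its orbit small up to a time [D / h s'], where
    [h s'] depends only on [s'] ([corrections_exist]).

    A common vector is a sum of such corrections.  Suppose that [x] has been
    built, and that the next task is to approach a finitely supported [y] along
    the orbit of [T s].  The correction [z] for [g = y - x] gives
    [T s^D (x + z) = x + g - z = y - z], hence
    [T s^(D + t) (x + z) = T s^t y - T s^t z] is close to [y] whenever [t] is a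
    multiple of the period of [y] and [t <= D / h s].  This happens on a
    fixed proportion of a period [2 D] of [x + z] ([frequent_start]).

    For positive lower density the visits must survive the stages devoted to
    other tasks.  At any later stage the new correction is small under [T s] up
    to time [D' / h s], so that the old visits persist there and, by
    periodicity, still have a fixed density in that window; relative to the new
    period [2 D'] only a factor depending on [h s] is lost ([frequent_next]).
    The tasks are scheduled so that each one recurs with bounded gaps
    ([ruler_recurrent]), so only boundedly many such factors accumulate before
    the proportion is restored ([frequent_always]).  Passing to the limit vector
    gives positive lower density of visits to every ball around a rational
    finitely supported vector ([limit_hits]), and these vectors are dense. *)

(* Otherwise simplification exposes the function behind [ell_unit]. *)
Arguments ell_seq : simpl never.
Arguments ell_unit : simpl never.

(** * The real-valued norm and finitely supported vectors *)

Section ell_real_norm.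
Context {R : realType} {p : R} {p1 : 1 <= p}.
Local Notation V := (ell p1).
Local Notation e := (@ell_unit R p p1).
Implicit Types (x y : V) (c : R[i]).

(** The norm of [ell p1] takes values in [R[i]]; all estimates are real. *)
Definition nrm x : R := fine (lpnorm p x).

Lemma ell_normE x : `|x| = (nrm x)%:C.
Proof. by []. Qed.

Lemma nrm_ge0 x : 0 <= nrm x.
Proof. by rewrite fine_ge0// lpnorm_ge0. Qed.

Lemma nrmE x : (nrm x)%:E = lpnorm p x.
Proof. by rewrite fineK// ge0_fin_numE ?lpnorm_ge0//; exact: (valP x). Qed.

Lemma nrmD x y : nrm (x + y) <= nrm x + nrm y.
Proof. by rewrite -lecR rmorphD -!ell_normE ler_normD. Qed.

Lemma nrmZ c x : nrm (c *: x) = normc c * nrm x.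
Proof. by apply: complexI; rewrite rmorphM -!ell_normE normrZ normrcE. Qed.

Lemma nrmN x : nrm (- x) = nrm x.
Proof. by apply: complexI; rewrite -!ell_normE normrN. Qed.

Lemma nrm0 : nrm (0 : V) = 0.
Proof. by apply: complexI; rewrite -!ell_normE normr0. Qed.

Lemma nrm_sum (I : Type) (r : seq I) (P : pred I) (F : I -> V) :
  nrm (\sum_(i <- r | P i) F i) <= \sum_(i <- r | P i) nrm (F i).
Proof.
elim/big_rec2: _ => [|i a b _ h]; first by rewrite nrm0.
by rewrite (le_trans (nrmD _ _))// lerD2l.
Qed.

Lemma ell_ext x y : (forall j, x j = y j) -> x = y.
Proof. by move=> h; apply: val_inj; apply/funext. Qed.

Lemma ellDE x y j : (x + y) j = x j + y j.
Proof. by []. Qed.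

Lemma ellBE x y j : (x - y) j = x j - y j.
Proof. by []. Qed.

Lemma ellZE c x j : (c *: x) j = c * x j.
Proof. by []. Qed.

Lemma ell_unitE k j : e k j = (j == k)%:R.
Proof. by []. Qed.

Lemma ell_sumE (I : Type) (r : seq I) (P : pred I) (F : I -> V) j :
  (\sum_(i <- r | P i) F i) j = \sum_(i <- r | P i) F i j.
Proof. exact: (big_morph (fun x : V => x j)). Qed.

Lemma nrm_unit k : nrm (e k) = 1.
Proof.
have p0 : 0 < p by exact: lt_le_trans ltr01 p1.
rewrite /nrm lpnormE//.
rewrite (@nneseriesD1 _ _ k xpredT)//; last first.
  by move=> n _; rewrite lee_fin powR_ge0.
rewrite eseries0 ?adde0; last first.
  by move=> n _ /negbTE; rewrite ell_unitE => ->; rewrite normc0 powR0// gt_eqF.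
by rewrite ell_unitE eqxx normc1 powR1 poweR_EFin powR1.
Qed.

Definition supported (M N : nat) x :=
  forall j, ~~ (M <= j < N)%N -> x j = 0.

Lemma supportedD M N x y :
  supported M N x -> supported M N y -> supported M N (x + y).
Proof. by move=> hx hy j hj; rewrite ellDE hx// hy// addr0. Qed.

Lemma supportedZ M N c x : supported M N x -> supported M N (c *: x).
Proof. by move=> hx j hj; rewrite ellZE hx// mulr0. Qed.

Lemma supportedB M N x y :
  supported M N x -> supported M N y -> supported M N (x - y).
Proof. by move=> hx hy j hj; rewrite ellBE hx// hy// subr0. Qed.

Lemma supported_unit k : supported k k.+1 (e k).
Proof.
move=> j hj; rewrite ell_unitE; case: eqP => // jk; move: hj.
by rewrite jk leqnn ltnSn.
Qed.

Lemma supported_sub M N M' N' x : (M' <= M)%N -> (N <= N')%N ->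
  supported M N x -> supported M' N' x.
Proof. by move=> hM hN hx j hj; apply: hx; lia. Qed.

Lemma supported_sum M N (I : Type) (r : seq I) (P : pred I) (F : I -> V) :
  (forall i, P i -> supported M N (F i)) ->
  supported M N (\sum_(i <- r | P i) F i).
Proof. by move=> h j hj; rewrite ell_sumE big1// => i /h; exact. Qed.

Lemma supported_decomp M x : supported 0 M x -> x = \sum_(j < M) x j *: e j.
Proof.
move=> hx; apply: ell_ext => j; rewrite ell_sumE.
have [jM|Mj] := ltnP j M; last first.
  have -> : x j = 0 by apply: hx; rewrite -leqNgt.
  symmetry; apply: big1 => i _.
  by rewrite ellZE ell_unitE gtn_eqF ?mulr0// (leq_trans (ltn_ord i)).
rewrite (bigD1 (Ordinal jM) isT) /=.
rewrite [X in _ = _ + X]big1 => [|i /negbTE ij].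
  by rewrite ellZE ell_unitE eqxx mulr1 addr0.
rewrite ellZE ell_unitE; case: eqP => [ji|_]; last by rewrite mulr0.
have ii : i = Ordinal jM by apply: val_inj.
by rewrite ii eqxx in ij.
Qed.

Lemma powR_nrm_ge M x : \sum_(j < M) normc (x j) `^ p <= nrm x `^ p.
Proof.
have p0 : 0 < p by exact: lt_le_trans ltr01 p1.
have s0 : (0 <= \sum_(0 <= n <oo) (normc (x n) `^ p)%:E)%E.
  by apply: nneseries_ge0 => n _ _; rewrite lee_fin powR_ge0.
rewrite -lee_fin -poweR_EFin nrmE lpnormE// -poweRrM mulVf ?gt_eqF//.
rewrite poweRe1// -sumEFin -(big_mkord xpredT (fun n => (normc (x n) `^ p)%:E)).
by apply: nneseries_lim_ge => n _; rewrite lee_fin powR_ge0.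
Qed.

Lemma lpnorm_le_partial (f : nat -> R[i]) (B : R) : 0 <= B ->
  (forall M, \sum_(j < M) normc (f j) `^ p <= B `^ p) ->
  (lpnorm p f <= B%:E)%E.
Proof.
move=> B0 h; have p0 : 0 < p by exact: lt_le_trans ltr01 p1.
rewrite lpnormE//.
have -> : B%:E = ((B `^ p)%:E `^ p^-1)%E.
  by rewrite poweR_EFin -powRrM mulfV ?gt_eqF// powRr1.
have s0 : (0 <= \sum_(0 <= n <oo) (normc (f n) `^ p)%:E)%E.
  by apply: nneseries_ge0 => n _ _; rewrite lee_fin powR_ge0.
have sB : (\sum_(0 <= n <oo) (normc (f n) `^ p)%:E <= (B `^ p)%:E)%E.
  apply: lime_le.
    by apply: is_cvg_nneseries => n _ _; rewrite lee_fin powR_ge0.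
  by apply: nearW => M; rewrite big_mkord sumEFin lee_fin.
apply: gt0_ler_poweR => //; first by rewrite invr_ge0 ltW.
- by rewrite in_itv/= leey andbT.
- by rewrite in_itv/= leey andbT lee_fin powR_ge0.
Qed.

(** A substitute for completeness that builds the limit of a sequence whose
    coordinates are eventually constant; it holds since the [p]-th power of the
    norm is the supremum of its partial sums. *)
Lemma ell_of_partial (f : nat -> R[i]) (B : R) :
  (forall M, exists x, nrm x <= B /\ forall j, (j < M)%N -> x j = f j) ->
  exists x, nrm x <= B /\ forall j, x j = f j.
Proof.
move=> h.
have B0 : 0 <= B by have [x [+ _]] := h 0%N; apply: le_trans; exact: nrm_ge0.
have fB : (lpnorm p f <= B%:E)%E.
  apply: lpnorm_le_partial => // M; have [x [xB xf]] := h M.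
  apply: (@le_trans _ _ (nrm x `^ p)).
    by rewrite -(eq_bigr _ (fun (i : 'I_M) _ => congr1 (fun c => normc c `^ p)
      (xf i (ltn_ord i)))); exact: powR_nrm_ge.
  by rewrite ge0_ler_powR ?nnegrE ?nrm_ge0// (le_trans ler01).
have ff : f \in lp_finite p1 by rewrite unfold_in /= (le_lt_trans fB) ?ltry.
exists (Ell ff); split => //.
by rewrite -lee_fin nrmE.
Qed.

(** If all truncations stayed away from [x], the partial sums of the [p]-th
    powers would stay away from [nrm x `^ p], so [nrm x] would be smaller than
    itself. *)
Lemma truncation_le x (eps : R) : 0 < eps ->
  exists M, nrm (x - \sum_(j < M) x j *: e j) <= eps.
Proof.
move=> eps0; have p0 : 0 < p by exact: lt_le_trans ltr01 p1.
pose S M := \sum_(j < M) normc (x j) `^ p.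
have [M hM] : exists M, nrm x `^ p - eps `^ p < S M.
  apply: contrapT => /forallNP h.
  have hS M : S M <= nrm x `^ p - eps `^ p by rewrite leNgt; apply/negP.
  pose B := (nrm x `^ p - eps `^ p) `^ p^-1.
  have Bp : B `^ p = nrm x `^ p - eps `^ p.
    rewrite -powRrM mulVf ?gt_eqF// powRr1//.
    by rewrite (le_trans _ (hS 0%N))// /S big_ord0.
  have : nrm x <= B.
    by rewrite -lee_fin nrmE; apply: lpnorm_le_partial; rewrite ?powR_ge0// Bp.
  move=> /(ge0_ler_powR (ltW p0)); rewrite !nnegrE nrm_ge0 powR_ge0 Bp.
  move=> /(_ isT isT); rewrite leNgt => /negP; apply.
  by rewrite ltrBlDr ltrDl powR_gt0.
exists M; set y := x - _.
have yE j : y j = if (j < M)%N then 0 else x j.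
  rewrite ellBE ell_sumE; case: ltnP => jM.
    rewrite (bigD1 (Ordinal jM) isT) /= big1 => [|i /eqP ij].
      by rewrite ellZE ell_unitE eqxx mulr1 addr0 subrr.
    rewrite ellZE ell_unitE; case: eqP => [ji|_]; last by rewrite mulr0.
    by case: ij; apply: val_inj.
  rewrite big1 ?subr0// => i _.
  by rewrite ellZE ell_unitE gtn_eqF ?mulr0// (leq_trans (ltn_ord i)).
rewrite -lee_fin nrmE; apply: lpnorm_le_partial; first exact: ltW.
have SS N : S (M + N)%N = S M + \sum_(j < N) normc (x (M + j)%N) `^ p.
  by rewrite /S big_split_ord.
move=> N; apply: (@le_trans _ _ (\sum_(j < M + N) normc (y j) `^ p)).
  rewrite addnC big_split_ord /= lerDl sumr_ge0// => i _; exact: powR_ge0.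
rewrite big_split_ord /= big1 ?add0r => [|i _]; last first.
  by rewrite yE ltn_ord normc0 powR0// gt_eqF.
have h : \sum_(j < N) normc (x (M + j)%N) `^ p <= eps `^ p.
  have := powR_nrm_ge (M + N) x; rewrite -/(S _) SS => h.
  by rewrite -(lerD2l (S M)) (le_trans h)// -lerBlDr ltW.
apply: le_trans h; apply: ler_sum => i _; rewrite yE.
by rewrite ltnNge leq_addr.
Qed.

Definition gaussian (q : rat * rat) : R[i] := (ratr q.1) +i* (ratr q.2).

Lemma normc_le_ReIm (a b : R) : normc (a +i* b) <= `|a| + `|b|.
Proof.
rewrite /= -(@ger0_norm _ (`|a| + `|b|)) ?addr_ge0// -sqrtr_sqr ler_wsqrtr//.
rewrite sqrrD !real_normK ?num_real//.
by have := mulr_ge0 (normr_ge0 a) (normr_ge0 b); lra.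
Qed.

Lemma gaussian_dense (c : R[i]) (eps : R) : 0 < eps ->
  exists q, normc (c - gaussian q) <= eps.
Proof.
case: c => a b eps0.
have H (r : R) : exists q : rat, `|r - ratr q| <= eps / 2.
  have [q] : exists q, ratr q \in `](r - eps / 2), (r + eps / 2)[.
    by apply: rat_in_itvoo; lra.
  by rewrite in_itv /= => /andP[h1 h2]; exists q; rewrite ler_norml; lra.
have [q1 h1] := H a; have [q2 h2] := H b; exists (q1, q2).
by rewrite (le_trans (normc_le_ReIm _ _))//; lra.
Qed.

Definition rational_vector (s : seq (rat * rat)) : V :=
  \sum_(j < size s) gaussian (nth (0, 0) s j) *: e j.

Lemma supported_rational s : supported 0 (size s) (rational_vector s).
Proof.
apply: supported_sum => i _; apply: supportedZ.
by apply: supported_sub (@supported_unit i).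
Qed.

Lemma rational_vector_dense x (eps : R) : 0 < eps ->
  exists s, nrm (x - rational_vector s) <= eps.
Proof.
move=> eps0; have e2 : 0 < eps / 2 by rewrite divr_gt0.
have [M hM] := truncation_le x e2.
have eM : 0 < eps / 2 / M.+1%:R by rewrite divr_gt0.
have /boolp.choice[q hq] : forall j : nat, exists q : rat * rat,
    normc (x j - gaussian q) <= eps / 2 / M.+1%:R.
  by move=> j; exact: gaussian_dense.
exists (mkseq q M).
rewrite -(subrK (\sum_(j < M) x j *: e j) x) -addrA.
rewrite (le_trans (nrmD _ _))// [leRHS](_ : _ = eps / 2 + eps / 2); last by lra.
apply: lerD => //.
rewrite /rational_vector size_mkseq -sumrB (le_trans (nrm_sum _ _ _))//.
apply: (@le_trans _ _ (\sum_(j < M) (eps / 2 / M.+1%:R))).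
  apply: ler_sum => i _; rewrite -scalerBl nrmZ nrm_unit mulr1.
  by rewrite nth_mkseq.
rewrite sumr_const card_ord -[leLHS]mulr_natr mulrAC ler_pdivrMr//.
by rewrite ler_pM2l// ler_nat.
Qed.

Lemma nbhs_nrm x (U : set V) : open U -> U x ->
  exists2 r : R, 0 < r & forall y, nrm (x - y) < r -> U y.
Proof.
move=> oU Ux; have : nbhs x U by apply: open_nbhs_nbhs.
move=> /nbhs_normP[r /= r0 h].
have rr : r = (complex.Re r)%:C.
  by apply/eqP; rewrite eq_complex /= eqxx; move: r0; rewrite ltcE => /andP[].
exists (complex.Re r); first by rewrite -ltcR -rr.
by move=> y hy; apply: h; rewrite /= ell_normE rr ltcR.
Qed.

(** The bound is a power of [2] because iterates of the operator are compared
    with the factor [2 ^ (delta k - tau k)]. *)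
Lemma bounded_operator (T : {linear V -> V}) : continuous T ->
  exists m, forall x, nrm (T x) <= 2 ^+ m * nrm x.
Proof.
move=> cT; have /linear_boundedP : bounded_near T (nbhs 0).
  by apply: continuous_linear_bounded; exact: cT.
move=> [r0 [r0real h]].
have rr : r0 = (complex.Re r0)%:C by rewrite RRe_real.
have [m hm] : exists m : nat, complex.Re r0 < m%:R.
  exists (Num.bound `|complex.Re r0|).
  by rewrite (le_lt_trans (ler_norm _))// archi_boundP.
have r0m : r0 < (2 ^+ m)%:C.
  by rewrite rr ltcR (lt_trans hm)// -natrX ltr_nat ltn_expl.
by exists m => x; have := h _ r0m x; rewrite !ell_normE -rmorphM lecR.
Qed.

End ell_real_norm.

(** * Orbits and periods of operators of C-type *)

Section linear_iterates.
Context {K : pzRingType} {V : lmodType K} (T : {linear V -> V}).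
Implicit Types x y : V.

Lemma iter_linearD n x y : iter n T (x + y) = iter n T x + iter n T y.
Proof. by elim: n => //= n ->; rewrite linearD. Qed.

Lemma iter_linearB n x y : iter n T (x - y) = iter n T x - iter n T y.
Proof. by elim: n => //= n ->; rewrite linearB. Qed.

Lemma iter_linear0 n : iter n T 0 = 0.
Proof. by elim: n => //= n ->; rewrite linear0. Qed.

Lemma iter_linearN n x : iter n T (- x) = - iter n T x.
Proof. by elim: n => //= n ->; rewrite linearN. Qed.

Lemma iter_linearZ n c x : iter n T (c *: x) = c *: iter n T x.
Proof. by elim: n => //= n ->; rewrite linearZ. Qed.

Lemma iter_linear_sum n (I : Type) (r : seq I) (P : pred I) (F : I -> V) :
  iter n T (\sum_(i <- r | P i) F i) = \sum_(i <- r | P i) iter n T (F i).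
Proof. by elim: n => //= n ->; rewrite linear_sum. Qed.

Lemma iter_period m n x : (m %| n)%N -> iter m T x = x -> iter n T x = x.
Proof. by case/dvdnP => q -> h; elim: q => // q ih; rewrite mulSn iterD ih. Qed.

End linear_iterates.

Section Ctype_orbits.
Context {R : realType} {p : R} {p1 : 1 <= p}.
Local Notation V := (ell p1).
Local Notation e := (@ell_unit R p p1).
Context (v w : nat -> R[i]) (phi b : nat -> nat) (T : {linear V -> V}).
Hypothesis hT : Ctype_operator v w phi b T.

Let hD := Ctype_operator_data hT.

Lemma b_lt n : (b n < b n.+1)%N.
Proof. exact: (Ctype_b_incr hD). Qed.

Lemma b_mono : {mono b : m n / (m <= n)%N}.
Proof. by apply: leq_mono; exact: (Ctype_b_incr hD). Qed.

Lemma b_ge n : (n <= b n)%N.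
Proof. by elim: n => // n ih; rewrite (leq_ltn_trans ih)// b_lt. Qed.

Lemma block_of j : exists n, (b n <= j < b n.+1)%N.
Proof.
elim: j => [|j [n /andP[h1 h2]]].
  by exists 0%N; have := b_lt 0; rewrite (Ctype_b0 hD).
have [h|h] := ltnP j.+1 (b n.+1); first by exists n; rewrite h (leq_trans h1).
by exists n.+1; rewrite h (leq_ltn_trans h2)// b_lt.
Qed.

Lemma weight_neq0 j : (1 <= j)%N -> w j != 0.
Proof.
move=> j1; apply/eqP => wj; have := Ctype_w_inf hD.
rewrite ltNge => /negP; apply.
by apply: ereal_inf_lbound; exists j => //; rewrite wj normc0.
Qed.

Lemma prod_weight_neq0 m n : (0 < m)%N -> \prod_(m <= j < n) w j != 0.
Proof.
move=> m0; rewrite big_nat prodf_seq_neq0; apply/allP => j _.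
by apply/implyP => /andP[mj _]; apply: weight_neq0; exact: leq_trans mj.
Qed.

Lemma block_orbit n i : (i < b n.+1 - b n)%N ->
  iter i T (e (b n)) =
  (\prod_((b n).+1 <= j < (b n + i).+1) w j) *: e (b n + i).
Proof.
elim: i => [|i ih] hi; first by rewrite addn0 big_geq//= scale1r.
rewrite iterS ih ?(ltn_trans _ hi)// linearZ /=.
rewrite (Ctype_operator_shift hT (n := n)); last by lia.
by rewrite scalerA addnS [in RHS]big_nat_recr ?ltnS ?leq_addr.
Qed.

Lemma block_unit n i : (i < b n.+1 - b n)%N ->
  e (b n + i) =
  (\prod_((b n).+1 <= j < (b n + i).+1) w j)^-1 *: iter i T (e (b n)).
Proof.
by move=> hi; rewrite block_orbit// scalerA mulVf ?scale1r// prod_weight_neq0.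
Qed.

Lemma block_return n : (1 <= n)%N ->
  iter (b n.+1 - b n) T (e (b n)) =
  ((\prod_((b n).+1 <= j < b n.+1) w j) * v n) *: e (b (phi n)) - e (b n).
Proof.
move=> n1; have bn := b_lt n.
have -> : (b n.+1 - b n)%N = (b n.+1 - b n).-1.+1 by lia.
rewrite iterS block_orbit; last by lia.
have -> : (b n + (b n.+1 - b n).-1)%N = (b n.+1).-1 by lia.
rewrite prednK; last by lia.
rewrite linearZ /= (Ctype_operator_end hT n1) scalerBr !scalerA.
rewrite mulfV ?scale1r//; exact: prod_weight_neq0.
Qed.

Lemma block_return0 : iter (b 1%N - b 0%N) T (e (b 0%N)) = - e (b 0%N).
Proof.
have bn := b_lt 0.
have -> : (b 1%N - b 0%N)%N = (b 1%N - b 0%N).-1.+1 by lia.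
rewrite iterS block_orbit; last by lia.
have -> : (b 0%N + (b 1%N - b 0%N).-1)%N = (b 1%N).-1 by lia.
rewrite prednK; last by lia.
rewrite linearZ /= (Ctype_operator_end0 hT) scalerN scalerA mulfV; last first.
  exact: prod_weight_neq0.
by rewrite scale1r (Ctype_b0 hD).
Qed.

(** By induction along [phi]: a turn around block [n] sends its first vector [u]
    to [c *: u' - u], where [u'] opens block [phi n] and is fixed by that number
    of steps; the second turn cancels [c *: u']. *)
Lemma block_period n i : (i < b n.+1 - b n)%N ->
  iter (2 * (b n.+1 - b n)) T (e (b n + i)) = e (b n + i).
Proof.
move=> hi; rewrite block_unit// iter_linearZ -iterD [(2 * _ + i)%N]addnC iterD.
suff -> : iter (2 * (b n.+1 - b n)) T (e (b n)) = e (b n) by [].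
move: {i hi}n; apply: ltn_ind => n ih; rewrite mul2n -addnn iterD.
case: n ih => [_|n ih].
  by rewrite block_return0 iter_linearN block_return0 opprK.
rewrite block_return// iter_linearB iter_linearZ block_return//.
rewrite (iter_period _ (ih _ _)); first by rewrite opprB addrC subrK.
  exact: (Ctype_b_dvd hD).
exact: (Ctype_phi_lt hD).
Qed.

End Ctype_orbits.

(** * Levels of operators of C_{+,1}-type *)

Section Cplus1_levels.
Context {R : realType} {p : R} {p1 : 1 <= p}.
Local Notation V := (ell p1).
Local Notation e := (@ell_unit R p p1).
Context (tau delta : nat -> int) (phi b Delta : nat -> nat).
Context (T : {linear V -> V}).
Hypothesis hT : Cplus1_operator tau delta phi b Delta T.

Lemma Cplus1_continuous : continuous T.
Proof. by case: hT => v [w [vk [wk [[_ h _ _ _] _ _]]]]. Qed.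

Lemma Cplus1_b_lt n : (b n < b n.+1)%N.
Proof. by case: hT => v [w [vk [wk [hC _ _]]]]; exact: b_lt hC n. Qed.

Lemma Cplus1_b_mono : {mono b : m n / (m <= n)%N}.
Proof. by case: hT => v [w [vk [wk [hC _ _]]]]; exact: b_mono hC. Qed.

Lemma Cplus1_b_ge n : (n <= b n)%N.
Proof. by case: hT => v [w [vk [wk [hC _ _]]]]; exact: b_ge hC n. Qed.

Lemma level_double k : (1 <= k)%N -> (2 ^ k = 2 ^ k.-1 + 2 ^ k.-1)%N.
Proof. by case: k => // k _; rewrite expnS mul2n addnn. Qed.

Lemma level_length k n : (1 <= k)%N -> (2 ^ k.-1 <= n < 2 ^ k)%N ->
  (b n.+1 - b n = Delta k)%N.
Proof. by case: hT => v [w [vk [wk [_ hP _]]]]; exact: (Cplus_Delta hP). Qed.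

Lemma level_dvd k n : (1 <= k)%N -> (n < 2 ^ k.-1)%N ->
  (2 * (b n.+1 - b n) %| Delta k)%N.
Proof.
case: hT => v [w [vk [wk [hC hP _]]]] k1 nk.
have hl : (2 ^ k.-1 <= n + 2 ^ k.-1 < 2 ^ k)%N.
  by rewrite leq_addl (level_double k1) ltn_add2r.
have := Ctype_b_dvd (Ctype_operator_data hC) (n := n + 2 ^ k.-1).
rewrite (Cplus_phi hP k1 hl) addnK (Cplus_Delta hP k1 hl); apply.
by rewrite addn_gt0 expn_gt0 orbT.
Qed.

Lemma level_gt0 k : (1 <= k)%N -> (0 < Delta k)%N.
Proof.
move=> k1; rewrite -(@level_length k (2 ^ k.-1)) ?subn_gt0 ?Cplus1_b_lt//.
by rewrite leqnn (level_double k1) -addn1 leq_add2l expn_gt0.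
Qed.

Lemma level_length_le k n : (1 <= k)%N -> (n < 2 ^ k)%N ->
  (2 * (b n.+1 - b n) %| 2 * Delta k)%N.
Proof.
move=> k1 nk; have [h|h] := ltnP n (2 ^ k.-1); last first.
  by rewrite (level_length k1)// h.
by rewrite dvdn_mull// level_dvd.
Qed.

Lemma level_growth k : (k < Delta k.+1)%N.
Proof.
elim: k => [|k ih]; first exact: level_gt0.
have h : (2 * Delta k.+1 %| Delta k.+2)%N.
  have hl : (2 ^ k <= 2 ^ k < 2 ^ k.+1)%N.
    by rewrite leqnn ltn_exp2l// ltnSn.
  by rewrite -(@level_length k.+1 (2 ^ k))// level_dvd// ltn_exp2l// ltnSn.
by have := dvdn_leq (level_gt0 (isT : 1 <= k.+2)%N) h; lia.
Qed.

Lemma block_below j n : (j < b n)%N ->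
  exists m i, [/\ (m < n)%N, (i < b m.+1 - b m)%N & j = (b m + i)%N].
Proof.
case: hT => v [w [vk [wk [hC _ _]]]] jn.
have [m /andP[h1 h2]] := block_of hC j.
exists m, (j - b m)%N; split; [|lia|lia].
by rewrite ltnNge -Cplus1_b_mono; lia.
Qed.

Lemma unit_period_below k j : (1 <= k)%N -> (j < b (2 ^ k.-1))%N ->
  iter (Delta k) T (e j) = e j.
Proof.
case: hT => v [w [vk [wk [hC _ _]]]] k1 /block_below[m [i [hm hi ->]]].
exact: iter_period (level_dvd k1 hm) (block_period hC hi).
Qed.

Lemma unit_period k j : (1 <= k)%N -> (j < b (2 ^ k))%N ->
  iter (2 * Delta k) T (e j) = e j.
Proof.
case: hT => v [w [vk [wk [hC _ _]]]] k1 /block_below[m [i [hm hi ->]]].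
exact: iter_period (level_length_le k1 hm) (block_period hC hi).
Qed.

Lemma period_of_units M d x : supported 0 M x ->
  (forall j, (j < M)%N -> iter d T (e j) = e j) -> iter d T x = x.
Proof.
move=> /supported_decomp -> h; rewrite iter_linear_sum; apply: eq_bigr => i _.
by rewrite iter_linearZ h.
Qed.

Lemma vector_period_below k x : (1 <= k)%N ->
  supported 0 (b (2 ^ k.-1)) x -> iter (Delta k) T x = x.
Proof.
move=> k1 hx; apply: period_of_units hx _ => j; exact: unit_period_below.
Qed.

Lemma vector_period k x : (1 <= k)%N ->
  supported 0 (b (2 ^ k)) x -> iter (2 * Delta k) T x = x.
Proof.
by move=> k1 hx; apply: period_of_units hx _ => j; exact: unit_period.
Qed.

Lemma level_product k n (w : nat -> R[i]) vk wk v :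
  Cplus_data v w phi b Delta vk wk -> Cplus1_data tau delta Delta vk wk ->
  (1 <= k)%N -> 0 <= delta k -> (2 ^ k.-1 <= n < 2 ^ k)%N ->
  (\prod_((b n).+1 <= j < b n.+1) w j) * v n = 2 ^ (delta k - tau k).
Proof.
move=> hP h1 k1 d0 hn.
have [d dE] : exists d : nat, delta k = d.
  by exists `|delta k|%N; rewrite gez0_abs.
have hl := level_length k1 hn; have bn := Cplus1_b_lt n.
have dD : (d < Delta k)%N.
  by rewrite -ltz_nat -dE; exact: (Cplus1_delta_lt h1 k1).
rewrite (Cplus_v hP k1 hn) (Cplus1_v h1 k1) expfzDr ?pnatr_eq0//; congr (_ * _).
have -> : b n.+1 = (b n + Delta k)%N by lia.
rewrite -[(b n).+1]add1n big_addn addKn.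
rewrite (@big_cat_nat _ _ _ d.+1) //=.
rewrite [X in X * _](eq_big_nat _ _ (F2 := fun=> 2)) => [|i hi]; last first.
  rewrite addnC (Cplus_w hP k1 hn) ?(Cplus1_w2 h1 k1)//; last by lia.
    by case/andP: hi.
  by rewrite dE lez_nat; case/andP: hi.
rewrite [X in _ * X](eq_big_nat _ _ (F2 := fun=> 1)) => [|i hi]; last first.
  rewrite addnC (Cplus_w hP k1 hn) ?(Cplus1_w1 h1 k1)//; try by lia.
by rewrite big1_eq mulr1 prodr_const_nat dE subSS subn0.
Qed.

(** [z] is the point of block [n + 2 ^ (k - 1)] that corresponds to [e j] in
    block [n], reached from the start of its block by the same number of steps
    and divided by the weights met in block [n]: this makes its return to
    block [n] a multiple of [e j] exactly.  Only the steps from the start of the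
    block matter for its norm, whence a bound [A] independent of [k]. *)
Lemma unit_shift j : exists A : R, forall k,
  (1 <= k)%N -> (j < b (2 ^ k.-1))%N -> 0 <= delta k ->
  exists z, [/\ supported (b (2 ^ k.-1)) (b (2 ^ k)) z, nrm z <= A &
    iter (Delta k) T z = 2 ^ (delta k - tau k) *: e j - z].
Proof.
case: (hT) => v [w [vk [wk [hC hP h1]]]].
have [n /andP[n1 n2]] := block_of hC j.
have [m hm] := bounded_operator Cplus1_continuous.
pose i := (j - b n)%N; have jE : j = (b n + i)%N by rewrite /i; lia.
have hi : (i < b n.+1 - b n)%N by lia.
pose c := (\prod_((b n).+1 <= j < (b n + i).+1) w j)^-1.
exists (normc c * (2 ^+ m) ^+ i) => k k1 hj d0.
have nk : (n < 2 ^ k.-1)%N by rewrite ltnNge -Cplus1_b_mono; lia.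
pose n' := (n + 2 ^ k.-1)%N.
have hl : (2 ^ k.-1 <= n' < 2 ^ k)%N.
  by rewrite leq_addl (level_double k1) ltn_add2r.
have iD : (i < Delta k)%N.
  apply: leq_trans hi _; apply: dvdn_leq (level_gt0 k1) _.
  by apply: dvdn_trans (level_dvd k1 nk); rewrite dvdn_mull.
exists (c *: iter i T (e (b n'))); split.
- apply: supportedZ; rewrite (block_orbit hC) ?(level_length k1 hl)//.
  apply: supportedZ; apply: supported_sub (@supported_unit _ _ _ _).
    by rewrite (leq_trans _ (leq_addr _ _))// Cplus1_b_mono; case/andP: hl.
  have := level_length k1 hl; have := Cplus1_b_lt n'.
  have : (b n'.+1 <= b (2 ^ k))%N by rewrite Cplus1_b_mono; case/andP: hl.
  lia.
- rewrite nrmZ ler_wpM2l ?normc_ge0//.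
  elim: (i) => [|i' ih]; first by rewrite expr0 /= nrm_unit.
  by rewrite iterS (le_trans (hm _))// exprS ler_wpM2l// exprn_ge0.
- rewrite iter_linearZ -iterD addnC iterD -(level_length k1 hl).
  rewrite (block_return hC); last by lia.
  rewrite (level_product hP h1 k1 d0 hl) (Cplus_phi hP k1 hl) addnK.
  rewrite iter_linearB iter_linearZ scalerBr scalerA mulrC -scalerA.
  by rewrite -(block_unit hC hi) -jE.
Qed.

Lemma vector_shift M g : supported 0 M g -> exists A : R, forall k,
  (1 <= k)%N -> (M <= b (2 ^ k.-1))%N -> 0 <= delta k ->
  exists z, [/\ supported (b (2 ^ k.-1)) (b (2 ^ k)) z, nrm z <= A &
    iter (Delta k) T z = 2 ^ (delta k - tau k) *: g - z].
Proof.
move=> /supported_decomp gE.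
have /boolp.choice[A hA] := unit_shift.
exists (\sum_(j < M) normc (g j) * A j) => k k1 Mk d0.
have /boolp.choice[z hz] : forall j : 'I_M, exists z,
    [/\ supported (b (2 ^ k.-1)) (b (2 ^ k)) z, nrm z <= A j &
      iter (Delta k) T z = 2 ^ (delta k - tau k) *: e j - z].
  by move=> j; apply: hA => //; exact: leq_trans Mk.
exists (\sum_(j < M) g j *: z j); split.
- by apply: supported_sum => j _; apply: supportedZ; case: (hz j).
- apply: le_trans (nrm_sum _ _ _) _; apply: ler_sum => j _.
  by rewrite nrmZ ler_wpM2l ?normc_ge0//; case: (hz j).
- rewrite iter_linear_sum {2}gE scaler_sumr -sumrB; apply: eq_bigr => j _.
  case: (hz j) => _ _ zE.
  by rewrite iter_linearZ zE scalerBr !scalerA mulrC.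
Qed.

End Cplus1_levels.

Lemma limn_esup_le {R : realType} (u : nat -> \bar R) K (c : \bar R) :
  (forall k, (K <= k)%N -> (u k <= c)%E) -> (limn_esup u <= c)%E.
Proof.
move=> uc; rewrite /limn_esup limf_esupE.
apply: (@le_trans _ _ (ereal_sup (u @` [set k | (K <= k)%N]))).
  by apply: ereal_inf_lbound; exists [set k | (K <= k)%N] => //; exists K.
by apply: ge_ereal_sup => _ [k /= Kk <-]; exact: uc.
Qed.

(** * Small corrections, uniformly over the family *)

Section family.
Context {R : realType} {p : R} {p1 : 1 <= p}.
Local Notation V := (ell p1).
Context (tau delta : nat -> nat -> int) (phi b Delta : nat -> nat).
Context (T : nat -> {linear V -> V}).
Hypothesis hT : forall s, (1 <= s)%N ->
  Cplus1_operator (tau s) (delta s) phi b Delta (T s).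

Lemma delta_eventually_ge0 s : (1 <= s)%N ->
  exists K, forall k, (K <= k)%N -> 0 <= delta s k.
Proof.
move=> /hT[v [w [vk [wk [_ _ /Cplus1_delta_incr h]]]]].
have hk k : delta s 1%N + k%:Z <= delta s k.+1.
  elim: k => [|k ih]; first by rewrite addr0.
  by have := h k.+1 k.+2; rewrite ltnSn => /(_ isT); lia.
exists (`|delta s 1%N|.+1)%N => -[//|k] hle.
have := hk k; lia.
Qed.

(** Any [N] with [1 / N] below the infimum works: if the inequality failed from
    some [K] on, the upper limit for that [s] would be at most [1 / N]. *)
Lemma uniform_ratio :
  (0 < ereal_inf [set limn_esup (fun k =>
         (((delta t k - tau t k)%:~R / (Delta k)%:R : R)%:E))
      | t in [set t | (1 <= t)%N]])%E ->
  exists2 N : nat, (0 < N)%N & forall s K, (1 <= s)%N ->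
    exists2 k, (K <= k)%N & (Delta k)%:Z <= N%:Z * (delta s k - tau s k).
Proof.
set I := ereal_inf _ => I0.
have [c c0 cI] : exists2 c : R, 0 < c & (c%:E <= I)%E.
  case: I I0 => [r| |] //= r0; first by exists r.
  by exists 1 => //; rewrite leey.
pose N := (Num.bound c^-1).+1.
have Nc : N%:R^-1 < c.
  rewrite invf_plt ?posrE// (lt_trans (archi_boundP _))// ?invr_ge0 ?(ltW c0)//.
  by rewrite ltr_nat.
exists N => // s K s1; apply: contrapT => hno.
have hk k : (K <= k)%N -> (1 <= k)%N ->
    (delta s k - tau s k)%:~R / (Delta k)%:R <= N%:R^-1 :> R.
  move=> Kk k1; have D0 := level_gt0 (hT s1) k1.
  rewrite ler_pdivrMr ?ltr0n// mulrC ler_pdivlMr ?ltr0n//.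
  rewrite !pmulrn -intrM ler_int leNgt; apply/negP => hlt.
  by apply: hno; exists k => //; rewrite mulrC ltW.
suff : (limn_esup (fun k => (((delta s k - tau s k)%:~R / (Delta k)%:R : R)%:E))
    <= N%:R^-1%:E)%E.
  apply/negP; rewrite -ltNge; apply: (@lt_le_trans _ _ c%:E).
    by rewrite lte_fin.
  by apply: le_trans cI _; apply: ereal_inf_lbound; exists s.
apply: (@limn_esup_le _ _ K.+1) => k Kk.
by rewrite lee_fin; apply: hk; lia.
Qed.

(** What one stage of the construction needs.  The error made in reaching [g] is
    [z] itself, so smallness of the orbit of [z] controls both the time before
    [D] and the time after it; the periods let [D] be added without disturbing
    what was built before. *)
Record correction (h : nat -> nat) (s M : nat) (g : V) (eps : R)
    (D : nat) (z : V) (M' : nat) : Prop := {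
  correction_bound : (M < M')%N ;
  correction_support : supported M M' z ;
  correction_hit : iter D (T s) z = g - z ;
  correction_small : forall s' t, (1 <= s')%N -> (h s' * t <= D)%N ->
    nrm (iter t (T s') z) <= eps ;
  correction_old : forall s' x, (1 <= s')%N -> supported 0 M x ->
    iter D (T s') x = x ;
  correction_new : forall s' x, (1 <= s')%N -> supported 0 M' x ->
    iter (2 * D) (T s') x = x }.

Lemma iter_bound (S : {linear V -> V}) m :
  (forall x, nrm (S x) <= 2 ^+ m * nrm x) ->
  forall t x, nrm (iter t S x) <= 2 ^+ (m * t) * nrm x.
Proof.
move=> hm t x; elim: t => [|t ih]; first by rewrite muln0 expr0 mul1r.
by rewrite iterS (le_trans (hm _))// mulnS exprD -mulrA ler_wpM2l.
Qed.

(** With [f = delta k - tau k >= D / N], the correction has size [A / 2 ^ f];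
    up to time [t] the operator [T s'] multiplies norms by at most
    [2 ^ (m s' * t)], which is at most [2 ^ (f / 2)] as long as
    [2 N (m s') t <= D]. *)
Lemma corrections_exist N : (0 < N)%N ->
  (forall s K, (1 <= s)%N ->
    exists2 k, (K <= k)%N & (Delta k)%:Z <= N%:Z * (delta s k - tau s k)) ->
  exists2 h : nat -> nat, (forall s, (0 < h s)%N) &
    forall s M g eps K, (1 <= s)%N -> supported 0 M g -> 0 < eps ->
    exists D z M', (K <= D)%N /\ correction h s M g eps D z M'.
Proof.
move=> N0 hN.
have /boolp.choice[m hm] : forall s, exists m, (1 <= s)%N ->
    forall x, nrm (T s x) <= 2 ^+ m * nrm x.
  case=> [|s]; first by exists 0%N.
  have [m hm] := bounded_operator (Cplus1_continuous (hT (isT : 1 <= s.+1)%N)).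
  by exists m.
exists (fun s => (2 * N * m s).+1) => // s M g eps K s1 gM eps0.
have [A hA] := vector_shift (hT s1) gM.
have [Kd hKd] := delta_eventually_ge0 s1.
pose m0 := Num.bound (`|A| / eps).
(* As [N * (2 * m0) <= k <= Delta k <= N * f] below, [2 * m0 <= f]; and
   [A <= 2 ^ m0 * eps]. *)
have [k hk hkN] := hN s (Kd + K + M + N * (2 * m0)).+1 s1.
have k1 : (1 <= k)%N by lia.
have kD : (k <= Delta k)%N.
  by have := level_growth (hT s1) k.-1; rewrite prednK.
pose f := `|delta s k - tau s k|%N.
have D0 := level_gt0 (hT s1) k1.
have fE : delta s k - tau s k = f%:Z.
  rewrite /f gez0_abs// leNgt; apply/negP => neg.
  have : N%:Z * (delta s k - tau s k) < 0 by rewrite pmulr_rlt0.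
  lia.
have Df : (Delta k <= N * f)%N by move: hkN; rewrite fE -PoszM lez_nat.
have fm : (2 * m0 <= f)%N by rewrite -(leq_pmul2l N0); lia.
have bM : (M <= b (2 ^ k.-1))%N.
  apply: leq_trans (Cplus1_b_ge (hT s1) _).
  apply: leq_trans (ltnW (ltn_expl _ _)) => //.
  lia.
have bb : (b (2 ^ k.-1) < b (2 ^ k))%N.
  by rewrite (leqW_mono (Cplus1_b_mono (hT s1))) ltn_exp2l// prednK.
have [|z [zS zA zD]] := hA k k1 bM; first by apply: hKd; lia.
rewrite fE -exprnP in zD.
have p2 n : 0 < 2 ^+ n :> R by rewrite exprn_gt0.
have p2c : (2 ^+ f : R[i]) != 0 by rewrite expf_neq0.
have nc : normc ((2 ^+ f)^-1 : R[i]) = (2 ^+ f)^-1.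
  apply: complexI; rewrite -normrcE ger0_norm ?invr_ge0 ?exprn_ge0//.
  by rewrite fmorphV rmorphXn rmorph_nat.
exists (Delta k), ((2 ^+ f)^-1 *: z), (b (2 ^ k)); split; first by lia.
split.
- exact: leq_ltn_trans bb.
- by apply: supportedZ; apply: supported_sub zS.
- by rewrite iter_linearZ zD scalerBr scalerA mulVf ?scale1r.
- move=> s' t s1' ht; rewrite iter_linearZ nrmZ nc ler_pdivrMl//.
  apply: le_trans (iter_bound (hm _ s1') _ _) _.
  have mt : (2 * (m s' * t) <= f)%N by rewrite -(leq_pmul2l N0); lia.
  have Am : A <= 2 ^+ m0 * eps.
    rewrite -ler_pdivrMr// (le_trans (_ : _ <= `|A| / eps))//.
      by rewrite ler_pM2r ?invr_gt0// ler_norm.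
    apply: ltW; apply: lt_trans (archi_boundP _) _.
      by rewrite divr_ge0 ?(ltW eps0).
    by rewrite -natrX ltr_nat ltn_expl.
  apply: (@le_trans _ _ (2 ^+ (m s' * t) * (2 ^+ m0 * eps))).
    by rewrite ler_pM2l// (le_trans zA).
  rewrite mulrA -exprD ler_pM2r// ler_eXn2l ?ltr1n//; lia.
- move=> s' x s1' hx; apply: (vector_period_below (hT s1') k1).
  exact: supported_sub hx.
- by move=> s' x s1' hx; exact: (vector_period (hT s1') k1).
Qed.

End family.

(** * Counting visits *)

Section counting.
Local Open Scope nat_scope.
Implicit Types E F : pred nat.

Definition cnt E n := count E (iota 0 n).

Lemma cnt_leq E m n : m <= n -> cnt E m <= cnt E n.
Proof. by move=> mn; rewrite /cnt -(subnKC mn) iotaD count_cat leq_addr. Qed.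

Lemma cnt_sub E F n : (forall t, t < n -> E t -> F t) -> cnt E n <= cnt F n.
Proof.
move=> h; rewrite /cnt (@eq_in_count _ E (predI E F)) => [|t].
  by apply: sub_count => t /= /andP[].
by rewrite mem_iota /= => tn; case: (boolP (E t)) => //= /(h _ tn) ->.
Qed.

Lemma cnt_progression E n D q c : 0 < q -> D + q * c <= n ->
  (forall i, i < c -> E (D + q * i)) -> c <= cnt E n.
Proof.
move=> q0 hn hE; rewrite /cnt -size_filter -{1}(size_iota 0 c).
rewrite -(size_map (fun i => D + q * i)); apply: uniq_leq_size.
  rewrite map_inj_uniq ?iota_uniq// => i j /addnI /eqP.
  by rewrite eqn_pmul2l// => /eqP.
move=> _ /mapP[i + ->]; rewrite mem_iota mem_filter mem_iota /= add0n => ic.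
rewrite hE//=; apply: leq_trans hn.
by rewrite ltn_add2l ltn_pmul2l.
Qed.

Lemma cnt_periods E P q : (forall t, E (t + P) = E t) ->
  cnt E (q * P) = q * cnt E P.
Proof.
move=> hE; elim: q => [|q ih]; first by rewrite mul0n.
rewrite !mulSn addnC {1}/cnt iotaD count_cat -/(cnt _ _) ih addnC.
congr (_ + _); rewrite /cnt.
rewrite add0n -[q * P]addn0 iotaDl count_map; apply: eq_count => t /=.
by elim: q {ih} => [|q ih]; rewrite ?mul0n// mulSn -addnA addnC hE.
Qed.

(** A proportion [1 / Q] in one period gives the proportion [1 / (2 Q)] in every
    longer window, as at least half of the window consists of full periods. *)
Lemma cnt_periodic_ge E P Q n : (forall t, E (t + P) = E t) -> 0 < P ->
  P <= cnt E P * Q -> P <= n -> n <= cnt E n * (2 * Q).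
Proof.
move=> hE P0 hQ Pn.
have q1 : 1 <= n %/ P by rewrite divn_gt0.
have h1 : n < (n %/ P).+1 * P by rewrite -ltn_divLR// ltnSn.
have h2 := cnt_leq E (leq_trunc_div n P); rewrite cnt_periods// in h2.
have h3 : (n %/ P) * P <= (n %/ P) * cnt E P * Q.
  by rewrite -mulnA leq_mul2l hQ orbT.
have h4 : (n %/ P) * cnt E P * Q <= cnt E n * Q by rewrite leq_mul2r h2 orbT.
move: q1 h1 h3 h4; rewrite mulSn mulnCA; nia.
Qed.

(** The 2-adic valuation visits every natural number with bounded gaps: it is
    [a] at the odd multiples of [2 ^ a]. *)
Lemma ruler_recurrent a l :
  exists2 m, l <= m <= l + 2 ^ a.+2 & logn 2 m.+1 = a.
Proof.
pose c := l %/ 2 ^ a.+1.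
have p0 : 0 < 2 ^ a by rewrite expn_gt0.
(* the first odd multiple of [2 ^ a] after the next multiple of [2 ^ (a + 1)] *)
exists (2 ^ a * (2 * c.+1).+1).-1.
  have h1 : l < c.+1 * 2 ^ a.+1 by rewrite -ltn_divLR ?expn_gt0.
  have h2 : c * 2 ^ a.+1 <= l by exact: leq_trunc_div.
  move: h1 h2; rewrite !expnS; move: (2 ^ a) p0 => A A0; nia.
rewrite prednK ?muln_gt0 ?p0// lognM// pfactorK//.
by rewrite logn_coprime ?addn0// coprime2n oddS oddM.
Qed.

End counting.

Lemma lower_density_gt0 {R : realType} (A : set nat) (E : pred nat) K Q :
  (forall t, E t -> A t) -> (0 < Q)%N ->
  (forall n, (K <= n)%N -> (n <= cnt E n * Q)%N) -> (0 < lower_density R A)%E.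
Proof.
move=> EA Q0 h; apply: (@lt_le_trans _ _ (Q%:R^-1)%:E).
  by rewrite lte_fin invr_gt0 ltr0n.
rewrite /lower_density /limn_einf leeNr; apply: (@limn_esup_le _ _ K) => n Kn.
rewrite leeN2 lee_fin ler_pdivlMr ?ltr0n// mulrC ler_pdivrMr ?ltr0n//.
rewrite -natrM ler_nat; apply: leq_trans (h n.+1 _) _; first exact: leqW.
rewrite leq_mul2r; apply/orP; right.
have -> : cnt E n.+1 = #|[pred i : 'I_n.+1 | E i]|.
  rewrite /cnt -sum1_card -(big_mkord E (fun=> 1%N)) -sum1_count.
  by rewrite /index_iota subn0.
apply: subset_leq_card; apply/fintype.subsetP => i.
rewrite !unfold_in /= => Ei; exact/mem_set/EA.
Qed.


(** * Construction of the common vector *)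

Section common_vector.
Context {R : realType} {p : R} {p1 : 1 <= p}.
Local Notation V := (ell p1).
Context (T : nat -> {linear V -> V}) (h : nat -> nat).
Hypothesis hT : forall s, (1 <= s)%N -> continuous (T s).
Hypothesis h0 : forall s, (0 < h s)%N.
Hypothesis hcorrection : forall s M g eps K,
  (1 <= s)%N -> supported 0 M g -> 0 < eps ->
  exists D z M', (K <= D)%N /\ correction T h s M g eps D z M'.

(** One number codes both the operator and its target, so that a single
    sequence schedules all of them; the operators start at index [1], whence the
    successor in [task_op]. *)
Definition task (a : nat) : nat * seq (rat * rat) :=
  odflt (0%N, [::]) (unpickle a).
Definition task_op a := (task a).1.+1.
Definition task_goal a : V := rational_vector (task a).2.
Definition task_size a := size (task a).2.

Record stage := Stage { st_vec : V; st_supp : nat; st_time : nat }.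

Definition half l : R := 2^-1 ^+ l.

(** Stage [l] treats the task given by the 2-adic valuation of [l + 1].  The
    times grow fast enough for the old period to fit, once [l] exceeds [h s],
    into the window in which the new correction is negligible under [T s]. *)
Definition stage_next (l : nat) (S S' : stage) :=
  let a := logn 2 l.+1 in
  (l.+1 * (4 * st_time S) < st_time S')%N /\
  correction T h (task_op a) (maxn (st_supp S) (task_size a))
    (task_goal a - st_vec S) (half l) (st_time S')
    (st_vec S' - st_vec S) (st_supp S').

Lemma half_gt0 l : 0 < half l.
Proof. by rewrite exprn_gt0// invr_gt0. Qed.

Lemma half_le l j : (l <= j)%N -> half j <= half l.
Proof. by move=> lj; rewrite ler_wiXn2l ?invr_ge0// invf_le1// ler1n. Qed.

Lemma halfE l : half l = 2 * half l.+1.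
Proof. by rewrite /half exprS mulrA mulfV ?mul1r// pnatr_eq0. Qed.

Lemma half_small (r : R) : 0 < r ->
  exists L, forall l, (L <= l)%N -> half l <= r.
Proof.
move=> r0; exists (Num.bound r^-1) => l Ll.
apply: le_trans (half_le Ll) _.
rewrite /half exprVn invf_ple ?posrE ?exprn_gt0//.
apply: ltW; apply: lt_trans (archi_boundP _) _; first by rewrite invr_ge0 ltW.
by rewrite -natrX ltr_nat ltn_expl.
Qed.

Lemma stages_exist : exists S : nat -> stage,
  S 0%N = Stage 0 0 1 /\ forall l, supported 0 (st_supp (S l)) (st_vec (S l)) /\
    stage_next l (S l) (S l.+1).
Proof.
have /boolp.choice[F hF] : forall lS : nat * stage, exists S',
    supported 0 (st_supp lS.2) (st_vec lS.2) -> stage_next lS.1 lS.2 S'.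
  move=> [l [x M D]] /=; case: (pselect (supported 0 M x)) => [hx|]; last first.
    by exists (Stage 0 0 1).
  have [|D' [z [M' [hD hz]]]] := hcorrection (s := task_op (logn 2 l.+1))
    (M := maxn M (task_size (logn 2 l.+1)))
    (g := task_goal (logn 2 l.+1) - x) (l.+1 * (4 * D)).+1 isT _ (half_gt0 l).
    apply: supportedB; last by apply: supported_sub hx; rewrite ?leq_maxl.
    by apply: supported_sub (@supported_rational _ _ _ _); rewrite // leq_maxr.
  exists (Stage (x + z) M' D') => _; split => //=.
  by rewrite [x + z]addrC addrK.
pose S := fix S l := if l is l'.+1 then F (l', S l') else Stage 0 0 1.
exists S; split => // l.
suff hs : supported 0 (st_supp (S l)) (st_vec (S l)).
  by split => //; exact: (hF (l, S l)).
elim: l => [|l ih]; first by [].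
have [_ [hM hS _ _ _ _]] := hF (l, S l) ih.
rewrite -[st_vec (S l.+1)](subrK (st_vec (S l))); apply: supportedD.
  exact: supported_sub hS.
by apply: supported_sub ih => //; rewrite (leq_trans (leq_maxl _ _) (ltnW hM)).
Qed.

Section limit.
Context (S : nat -> stage).
Hypothesis S0 : S 0%N = Stage 0 0 1.
Hypothesis hS : forall l, supported 0 (st_supp (S l)) (st_vec (S l)) /\
    stage_next l (S l) (S l.+1).

Let x l := st_vec (S l).
Let M l := st_supp (S l).
Let D l := st_time (S l).
Let a l := logn 2 l.+1.

Let hD l : (l.+1 * (4 * D l) < D l.+1)%N. Proof. by case: (hS l) => _ []. Qed.
Let hz l : correction T h (task_op (a l)) (maxn (M l) (task_size (a l)))
  (task_goal (a l) - x l) (half l) (D l.+1) (x l.+1 - x l) (M l.+1).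
Proof. by case: (hS l) => _ []. Qed.
Let hx l : supported 0 (M l) (x l). Proof. by case: (hS l). Qed.

Let D_gt0 l : (0 < D l)%N.
Proof.
by case: l => [|l]; [rewrite /D S0|rewrite (leq_ltn_trans _ (hD l))].
Qed.

Let D_lt l : (D l < D l.+1)%N.
Proof. by apply: leq_ltn_trans (hD l); have := D_gt0 l; nia. Qed.

Let D_mono : {mono D : m n / (m <= n)%N}.
Proof. by apply: leq_mono; apply: homo_ltn => //; exact: ltn_trans. Qed.

Let D_gt l : (l < D l)%N.
Proof.
by elim: l => [|l ih]; [exact: D_gt0|exact: leq_ltn_trans ih (D_lt l)].
Qed.

Let M_lt l : (M l < M l.+1)%N.
Proof. by apply: leq_ltn_trans (correction_bound (hz l)); rewrite leq_maxl. Qed.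

Let M_mono : {mono M : m n / (m <= n)%N}.
Proof. by apply: leq_mono; apply: homo_ltn => //; exact: ltn_trans. Qed.

Let M_ge l : (l <= M l)%N.
Proof. by elim: l => // l ih; exact: leq_ltn_trans ih (M_lt l). Qed.

Let x_stable l j i : (l <= j)%N -> (i < M l)%N -> x j i = x l i.
Proof.
move=> lj il; elim: j lj => [|j ih]; first by rewrite leqn0 => /eqP ->.
rewrite leq_eqVlt => /predU1P[-> //|lj]; rewrite -ih//.
have iM : (i < M j)%N by apply: leq_trans il _; rewrite M_mono.
rewrite -[x j.+1](subrK (x j)) ellDE.
have -> : (x j.+1 - x j) i = 0 by apply: (correction_support (hz j)); lia.
by rewrite add0r.
Qed.

Let x_close s t l j : (1 <= s)%N -> (h s * t <= D l.+1)%N -> (l <= j)%N ->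
  nrm (iter t (T s) (x j - x l)) <= 2 * half l - 2 * half j.
Proof.
move=> s1 ht lj; elim: j lj => [|j ih].
  by rewrite leqn0 => /eqP ->; rewrite !subrr iter_linear0 nrm0.
rewrite leq_eqVlt => /predU1P[-> |lj].
  by rewrite !subrr iter_linear0 nrm0.
rewrite -[x j.+1](subrK (x j)) -addrA iter_linearD.
apply: le_trans (nrmD _ _) _.
have hj : (h s * t <= D j.+1)%N by apply: leq_trans ht _; rewrite D_mono.
have := correction_small (hz j) s1 hj.
by have := ih lj; rewrite (halfE j); lra.
Qed.

(** The corrections have disjoint supports, so the stages converge
    coordinatewise; the tail after stage [l] is small under [T s] for the same
    times as its first correction. *)
Let limit_exists : exists X : V, forall s t l,
  (1 <= s)%N -> (h s * t <= D l.+1)%N ->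
  nrm (iter t (T s) (X - x l)) <= 3 * half l.
Proof.
pose f i := x i.+1 i.
have W l : exists w : V, nrm w <= 2 * half l /\ forall i, w i = f i - x l i.
  apply: ell_of_partial => N; exists (x (l + N)%N - x l); split.
    have := @x_close 1 0 l (l + N)%N isT.
    rewrite muln0 leq_addr => /(_ isT isT) /=.
    by move/le_trans; apply; rewrite gerBl mulr_ge0// ltW// half_gt0.
  move=> i iN; rewrite ellBE; congr (_ - _).
  by apply: x_stable; [lia|exact: M_ge].
have [w [_ hw]] := W 0%N.
exists (w + x 0%N) => s t l s1 ht.
have XE i : (w + x 0%N) i = f i by rewrite ellDE hw subrK.
have Xl j : nrm (w + x 0%N - x j) <= 2 * half j.
  have [w' [h1 h2]] := W j; rewrite (_ : _ - _ = w')//.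
  by apply: ell_ext => i; rewrite ellBE XE h2.
have [m hm] := bounded_operator (hT s1).
(* late enough for the growth [2 ^+ (m * t)] to be absorbed by [half j] *)
pose j := (l + m * t + 1)%N.
rewrite -(subrK (x j) (w + x 0%N)) -addrA iter_linearD.
apply: le_trans (nrmD _ _) _.
have lj : (l <= j)%N by lia.
have := x_close s1 ht lj; have := half_gt0 j.
have := iter_bound hm t (w + x 0%N - x j).
have : 2 ^+ (m * t) * nrm (w + x 0%N - x j) <= 2 ^+ (m * t) * (2 * half j).
  by rewrite ler_pM2l ?exprn_gt0.
have -> : 2 ^+ (m * t) * (2 * half j) = half l.
  rewrite /half /j !exprD expr1 !exprVn; field.
  by rewrite expf_neq0 ?pnatr_eq0// expf_neq0 ?pnatr_eq0.
lra.
Qed.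

Section one_target.
Variable c : nat.
Let s := task_op c.
Let y := task_goal c.
Let H := h s.
Let H0 : (0 < H)%N := h0 s.

Definition hit (r : R) l : pred nat :=
  fun t => nrm (iter t (T s) (x l) - y) <= r.

Let frequent r l Q := (2 * D l <= cnt (hit r l) (2 * D l) * Q)%N.

Let hit_periodic r l t : hit r l.+1 (t + 2 * D l.+1) = hit r l.+1 t.
Proof.
by rewrite /hit iterD (correction_new (hz l))//; exact: hx.
Qed.

Let y_period : exists2 q, (0 < q)%N & iter q (T s) y = y.
Proof.
exists (2 * D (task_size c).+1)%N; first by rewrite muln_gt0 D_gt0.
apply: (correction_new (hz _)) => //.
apply: supported_sub (@supported_rational _ _ _ _) => //.
by rewrite ltnW// (leq_trans _ (M_ge _)).
Qed.

(** From time [D l.+1] on, the orbit of [x l.+1] shadows that of [y] for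
    [D l.+1 / H] steps, and the latter is back at [y] every [q] steps. *)
Let frequent_start q : (0 < q)%N -> iter q (T s) y = y -> forall l, a l = c ->
  (H * q <= l)%N -> frequent (half l) l.+1 (4 * (H * q)).
Proof.
move=> q0 qy l al lHq; rewrite /frequent.
pose n := (D l.+1 %/ (H * q))%N.
have Hq0 : (0 < H * q)%N by rewrite muln_gt0 H0.
have n0 : (1 <= n)%N.
  by rewrite divn_gt0// (leq_trans lHq)// ltnW// (ltn_trans _ (D_gt _)).
have h1 : (D l.+1 < n.+1 * (H * q))%N by rewrite -ltn_divLR// ltnSn.
have h2 : (n * (H * q) <= D l.+1)%N by exact: leq_trunc_div.
suff : (n <= cnt (hit (half l) l.+1) (2 * D l.+1))%N.
  move: h1; rewrite mulSn; move: (H * q)%N Hq0 => B B0; nia.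
apply: (@cnt_progression _ _ (D l.+1) q) => // [|i il].
  have : (q * n <= n * (H * q))%N by nia.
  lia.
have E : iter (D l.+1) (T s) (x l.+1) = y - (x l.+1 - x l).
  have := correction_hit (hz l); rewrite al => hzl.
  have old : iter (D l.+1) (T s) (x l) = x l.
    apply: (correction_old (hz l)) => //.
    by apply: supported_sub (@hx l) => //; rewrite leq_maxl.
  rewrite -[in LHS](subrK (x l) (x l.+1)) iter_linearD hzl old.
  by rewrite -/y addrAC subrK.
rewrite /hit addnC iterD E iter_linearB (iter_period _ qy) ?dvdn_mulr//.
rewrite addrAC subrr sub0r nrmN.
apply: (correction_small (hz l)) => //; rewrite -/H.
have : (q * i <= q * n)%N by rewrite leq_mul2l ltnW ?orbT.
by nia.
Qed.

(** A stage devoted to another task dilutes the visits at most by the factor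
    [8 * H], which does not depend on the stage: they persist up to time
    [D l.+2 / H]. *)
Let frequent_next r l Q : frequent r l.+1 Q -> (H <= l)%N ->
  frequent (r + half l.+1) l.+2 (8 * H * Q).
Proof.
move=> hc Hl; rewrite /frequent.
pose n := (D l.+2 %/ H)%N.
have h1 : (D l.+2 < n.+1 * H)%N by rewrite -ltn_divLR// ltnSn.
have h2 : (n * H <= D l.+2)%N by exact: leq_trunc_div.
have nD : (2 * D l.+1 <= n)%N.
  rewrite leq_divRL//; have := hD l.+1; have := D_gt0 l.+1.
  by move: (D l.+1) (D l.+2) => A B; nia.
have h3 := cnt_periodic_ge (hit_periodic r l) _ hc nD.
rewrite muln_gt0 D_gt0 in h3; have {}h3 := h3 isT.
have h4 : (cnt (hit r l.+1) n <= cnt (hit (r + half l.+1) l.+2) (2 * D l.+2))%N.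
  apply: leq_trans (cnt_leq _ (_ : (n <= _)%N)); last by nia.
  apply: cnt_sub => t tn; rewrite /hit => ht.
  rewrite -[x l.+2](subrK (x l.+1)) iter_linearD -addrA addrC.
  apply: le_trans (nrmD _ _) _; apply: lerD => //.
  apply: (correction_small (hz l.+1)) => //; rewrite -/H; nia.
have n0 : (1 <= n)%N by apply: leq_trans nD; rewrite muln_gt0 D_gt0.
have h5 : (D l.+2 <= 2 * H * n)%N by nia.
have h6 : (n <= cnt (hit (r + half l.+1) l.+2) (2 * D l.+2) * (2 * Q))%N.
  by apply: leq_trans h3 _; rewrite leq_mul2r h4 orbT.
have h7 : (4 * H * n <=
    4 * H * (cnt (hit (r + half l.+1) l.+2) (2 * D l.+2) * (2 * Q)))%N.
  by rewrite leq_mul2l h6 orbT.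
lia.
Qed.

(** Both the radius and the proportion are restored whenever the task returns,
    so between two returns they deteriorate only a bounded number of times. *)
Let frequent_always (r : R) : 0 < r ->
  exists L Q, forall l, (L <= l)%N -> frequent r l.+1 Q.
Proof.
move=> r0; have [q q0 qy] := y_period.
pose G := (2 ^ c.+2)%N.
have [L1 hL1'] : exists L1, forall l, (L1 <= l)%N -> half l <= r / G.+1%:R.
  by apply: half_small; rewrite divr_gt0.
have hL1 l : (L1 <= l)%N -> G.+1%:R * half l <= r.
  by move=> /hL1'; rewrite ler_pdivlMr// mulrC.
exists (G + (L1 + H * q + H))%N, (4 * (H * q) * (8 * H) ^ G)%N => l Ll.
have [l0 /andP[l1 l2] al] := ruler_recurrent c (l - G).
have hl i :
    frequent (i.+1%:R * half l0) (l0 + i).+1 (4 * (H * q) * (8 * H) ^ i).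
  elim: i => [|i ih].
    by rewrite mul1r addn0 expn0 muln1; apply: frequent_start => //; lia.
  have Hl : (H <= l0 + i)%N by lia.
have := frequent_next ih Hl.
rewrite /frequent addnS => hh; apply: leq_trans hh _.
rewrite [(8 * H * _)%N]mulnCA -expnS leq_mul2r; apply/orP; right.
apply: cnt_sub => t _; rewrite /hit => /le_trans; apply.
rewrite -[in leRHS]natr1 mulrDl mul1r lerD2l.
by apply: half_le; lia.
have li : (l - l0 <= G)%N by lia.
have -> : l = (l0 + (l - l0))%N by rewrite subnKC//; lia.
move: (hl (l - l0)%N); rewrite /frequent => /leq_trans; apply.
apply: leq_mul; last first.
  by rewrite leq_mul2l leq_exp2l ?li ?orbT//; lia.
apply: cnt_sub => t _; rewrite /hit => /le_trans; apply.
apply: le_trans (hL1 l0 _); last by lia.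
by rewrite ler_pM2r ?half_gt0// ler_nat.
Qed.

(** Let [D j.+2 <= H * n < D j.+3].  If [n] exceeds the period of [x j.+2], its
    visits below [n] are numerous and are shared by [X].  Otherwise [n] is less
    than [2 * D j.+2], and the visits of [x j.+1] below [D j.+2 / H], which is
    comparable to [n], suffice. *)
Lemma limit_hits X : (forall s t l, (1 <= s)%N -> (h s * t <= D l.+1)%N ->
    nrm (iter t (T s) (X - x l)) <= 3 * half l) ->
  forall r, 0 < r -> exists K Q, (0 < Q)%N /\ forall n, (K <= n)%N ->
    (n <= cnt (fun t => (nrm (iter t (T s) X - y) <= r)%R) n * Q)%N.
Proof.
move=> hX r r0; have r2 : 0 < r / 2 by rewrite divr_gt0.
have r6 : 0 < r / 6 by rewrite divr_gt0.
have [L1 [Q hQ]] := frequent_always r2; have [L2 hL2] := half_small r6.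
pose E : pred nat := fun t => nrm (iter t (T s) X - y) <= r.
have hitX l t : (L2 <= l)%N -> (H * t <= D l.+1)%N -> hit (r / 2) l t -> E t.
  move=> Ll ht; rewrite /hit /E => hh.
  rewrite -(subrK (x l) X) iter_linearD -addrA.
  apply: le_trans (nrmD _ _) _.
  have := hX s t l isT ht; have := hL2 l Ll; lra.
have freq l n : (L1 <= l)%N -> (L2 <= l)%N -> (2 * D l.+1 <= n)%N ->
    (H * n <= D l.+2)%N -> (n <= cnt E n * (2 * Q))%N.
  move=> l1 l2 hn Hn; have D0 : (0 < 2 * D l.+1)%N by rewrite muln_gt0 D_gt0.
  have := cnt_periodic_ge (hit_periodic (r / 2) l) D0 (hQ l l1) hn.
  move=> /leq_trans; apply; rewrite leq_mul2r; apply/orP; right.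
  apply: cnt_sub => t tn; apply: hitX; first exact: leqW.
  apply: leq_trans Hn; rewrite leq_mul2l ltnW ?orbT//.
pose L := (L1 + L2 + H)%N.
exists (D L.+2), (8 * H * Q.+1)%N; split; first by rewrite !muln_gt0 H0.
move=> n hn.
have ex : exists l, (H * n < D l)%N by exists (H * n)%N; exact: D_gt.
case: (ex_minnP ex) => l0 hl0 hmin.
have Ll0 : (L.+2 < l0)%N.
  rewrite ltnNge -D_mono -ltnNge; apply: leq_ltn_trans hl0.
  by apply: leq_trans hn _; rewrite leq_pmull.
have [j jE] : exists j, l0 = j.+3 by exists (l0 - 3)%N; lia.
have jL : (L <= j)%N by lia.
have Dj : (D j.+2 <= H * n)%N.
  by rewrite leqNgt; apply/negP => /hmin; rewrite jE ltnn.
have [big|small] := leqP (2 * D j.+2) n.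
  have := freq j.+1 n; rewrite jE in hl0.
  move=> /(_ _ _ big (ltnW hl0)) f.
  have : (n <= cnt E n * (2 * Q))%N by apply: f; lia.
  by move=> /leq_trans; apply; rewrite leq_mul2l; apply/orP; right; nia.
pose n' := (D j.+2 %/ H)%N.
have h1 : (D j.+2 < n'.+1 * H)%N by rewrite -ltn_divLR// ltnSn.
have h2 : (n' * H <= D j.+2)%N by exact: leq_trunc_div.
have n'n : (n' <= n)%N by rewrite -(leq_pmul2r H0); lia.
have n'D : (2 * D j.+1 <= n')%N.
  rewrite leq_divRL//; have := hD j.+1; have := D_gt0 j.+1.
  have : (H <= j)%N by lia.
  by move: (D j.+1) (D j.+2) => A B; nia.
have f : (n' <= cnt E n' * (2 * Q))%N by apply: (freq j) => //; lia.
have n'0 : (1 <= n')%N by apply: leq_trans n'D; rewrite muln_gt0 D_gt0.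
have h3 : (n <= 4 * H * n')%N by nia.
have h4 : (4 * H * n' <= 4 * H * (cnt E n * (2 * Q)))%N.
  rewrite leq_mul2l; apply/orP; right; apply: leq_trans f _.
  by rewrite leq_mul2r cnt_leq ?orbT.
apply: leq_trans h3 (leq_trans h4 _).
have -> : (4 * H * (cnt E n * (2 * Q)) = cnt E n * (8 * H * Q))%N by lia.
by rewrite !leq_mul2l leqnSn !orbT.
Qed.

End one_target.

Lemma limit_FHC : exists X : V, forall s, (1 <= s)%N -> FHC (T s) X.
Proof.
have [X hX] := limit_exists; exists X => s s1 U oU [y0 Uy0].
have [r r0 hr] := nbhs_nrm oU Uy0.
have r2 : 0 < r / 2 by rewrite divr_gt0.
have r4 : 0 < r / 4 by rewrite divr_gt0.
have [q hq] := rational_vector_dense y0 r4.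
pose c := pickle (s.-1, q).
have cE : task c = (s.-1, q) by rewrite /task pickleK.
have sE : task_op c = s by rewrite /task_op cE prednK.
have [K [Q [Q0 hK]]] := @limit_hits c X hX _ r4.
apply: lower_density_gt0 Q0 hK => t; rewrite sE /task_goal cE /= => ht.
apply: hr; rewrite -(subrK (rational_vector q) y0) -addrA.
apply: le_lt_trans (nrmD _ _) _.
by rewrite -[nrm (rational_vector q - _)]nrmN opprB; lra.
Qed.

End limit.

Lemma common_FHC : exists X : V, forall s, (1 <= s)%N -> FHC (T s) X.
Proof. by have [S [S0 hS]] := stages_exist; exact: limit_FHC S0 hS. Qed.

End common_vector.

Theorem theorem3p4 (R : realType) (p : R) (p1 : 1 <= p)
    (tau delta : nat -> nat -> int) (phi b Delta : nat -> nat)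
    (T : nat -> {linear ell p1 -> ell p1})
    (hT : forall s, (1 <= s)%N ->
      Cplus1_operator (tau s) (delta s) phi b Delta (T s))
    (hinf : (0 < ereal_inf
      [set limn_esup (fun k =>
         (((delta t k - tau t k)%:~R / (Delta k)%:R : R)%:E))
      | t in [set t | (1 <= t)%N]])%E) :
  \bigcap_(s in [set s | (1 <= s)%N]) FHC (T s) !=set0.
Proof.
have [N N0 hN] := uniform_ratio hT hinf.
have [h h0 hcorrection] := corrections_exist hT N0 hN.
have hc s : (1 <= s)%N -> continuous (T s) by move=> /hT/Cplus1_continuous.
by have [X hX] := common_FHC hc h0 hcorrection; exists X => s; exact: hX.
Qed.
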